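(* Assume $\mathrm{cof}(\mathcal N)=\mathrm{add}(\mathcal N)$. Then for each $R\in\{\in^*,\leq^*,\neq^*\}$ we have $\mathfrak b(R_{\mathcal N})=\mathfrak b(R_{\mathcal M})$ and $\mathfrak d(R_{\mathcal N})=\mathfrak d(R_{\mathcal M})$.
   Context: $\omega^\omega$ is Baire space with Lebesgue measure $\mu$: the (completed) Borel measure with $\mu(N_s)=\prod_{i<\mathrm{length}(s)}2^{-(s(i)+1)}$ for $s\in\omega^{<\omega}$, where $N_s=\{x\in\omega^\omega: s\subseteq x\}$. $\mathcal N$ is the ideal of $\mu$-null subsets of $\omega^\omega$ and $\mathcal M$ the ideal of meager subsets of $\omega^\omega$. $\mathrm{add}(\mathcal N)$ is the least size of a family of null sets whose union is not null; $\mathrm{cof}(\mathcal N)$ is the least size of a family $\mathcal B\subseteq\mathcal N$ such that every null set is contained in a member of $\mathcal B$. A slalom is a function $s:\omega\to[\omega]^{<\omega}$ with $|s(n)|\le n$ for all $n$; $\mathcal S$ is the set of slaloms. For $x,y\in\omega^\omega$ and $s\in\mathcal S$: $x\leq^* y$ iff $x(n)\le y(n)$ for all but finitely many $n$; $x\neq^* y$ iff $x(n)\ne y(n)$ for all but finitely many $n$; $x\in^* s$ iff $x(n)\in s(n)$ for all but finitely many $n$. For $\mathcal I\in\{\mathcal N,\mathcal M\}$, $R\in\{\leq^*,\neq^*,\in^*\}$, $f:\omega^\omega\to\omega^\omega$ and $g:\omega^\omega\to\omega^\omega$ ($g:\omega^\omega\to\mathcal S$ if $R$ is $\in^*$), write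 $f R_{\mathcal I} g$ iff $\{x\in\omega^\omega:\neg\, f(x) R g(x)\}\in\mathcal I$. Then $\mathfrak b(R_{\mathcal I})$ is the least size of a set $A$ of functions $\omega^\omega\to\omega^\omega$ for which there is no $g:\omega^\omega\to\omega^\omega$ (no $g:\omega^\omega\to\mathcal S$ if $R$ is $\in^*$) with $f R_{\mathcal I} g$ for all $f\in A$; and $\mathfrak d(R_{\mathcal I})$ is the least size of a set $A$ of functions $\omega^\omega\to\omega^\omega$ (functions $\omega^\omega\to\mathcal S$ if $R$ is $\in^*$) such that for every $g:\omega^\omega\to\omega^\omega$ there is $f\in A$ with $g R_{\mathcal I} f$. *)

(* Defs.v *)
From HB Require Import structures.
From mathcomp Require Import all_boot all_order all_algebra finmap.
From mathcomp Require Import all_classical all_reals all_analysis.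

Set Implicit Arguments.
Unset Strict Implicit.
Unset Printing Implicit Defensive.

Import Order.TTheory GRing.Theory Num.Theory.
Local Open Scope classical_set_scope.
Local Open Scope card_scope.
Local Open Scope ring_scope.

(* Cardinals are represented by sets up to equinumerosity: [min_size P] is a
   member of [P] of least cardinality, so that "the least sizes of members of P
   and of Q coincide" reads [min_size P #= min_size Q].  The default [set0] is
   irrelevant when [P] is nonempty, see [min_sizeP]. *)
Definition is_min_size (T : Type) (P : set (set T)) (A : set T) : Prop :=
  P A /\ forall B, P B -> A #<= B.

Definition min_size (T : Type) (P : set (set T)) : set T :=
  xget set0 (is_min_size P).

Lemma min_sizeP (T : Type) (P : set (set T)) :
  P !=set0 -> is_min_size P (min_size P).
Proof.
move=> [A0 PA0]; rewrite /min_size.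
suff [A PA] : exists A, is_min_size P A by apply: xgetPex; exists A.
have [P0|A0P] := pselect (P set0).
  by exists set0; split=> // B _; exact: card_ge0.
pose sel (h : set T -> T) := forall A, P A -> A (h A).
pose good (M : set (set T -> T)) := M `<=` sel /\
  forall (h k : set T -> T) A, M h -> M k -> P A -> h A = k A -> h = k.
have [|M [[Msel Minj] Mmax]] := @Zorn_bigcup _ good.
  move=> F Fgood Ftot; split=> [h [X FX Xh]|h k A [X FX Xh] [Y FY Yk] PA hk].
    by have [+ _] := Fgood _ FX; exact.
  have [XY|YX] := Ftot _ _ FX FY.
    by have [_ /(_ h k A (XY _ Xh) Yk PA hk)] := Fgood _ FY.
  by have [_ /(_ h k A Xh (YX _ Yk) PA hk)] := Fgood _ FX.
have [A [PA surj]] : exists A, P A /\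
    forall a, A a -> exists h, M h /\ h A = a.
  apply: contrapT => /forallNP nsurj.
  have /choice[h hP] : forall A, exists a,
      P A -> A a /\ forall k, M k -> k A <> a.
    move=> A; have [PA|nPA] := pselect (P A); last first.
      have [a _] : A0 !=set0 by apply/set0P/eqP => A00; apply: A0P; rewrite -A00.
      by exists a.
    have /not_andP[//|/existsNP[a /not_implyP[Aa /forallNP na]]] := nsurj A.
    by exists a => _; split=> // k Mk kA; exact: (na k).
  have nMh : ~ M h by move=> Mh; have [_ /(_ _ Mh)] := hP _ PA0; exact.
  apply: (Mmax (M `|` [set h])).
    by split; [exact: subsetUl | move=> /(_ h (or_intror erefl))].
  split=> [k [/Msel//|->] A PA|k l A [Mk|->] [Ml|->] PA kl //].
  - by have [] := hP _ PA.
  - exact: Minj kl.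
  - by have [_ /(_ _ Mk)] := hP _ PA.
  - by have [_ /(_ _ Ml)] := hP _ PA; rewrite kl.
exists A; split=> // B PB.
have MA : A = (fun h => h A) @` M.
  apply/seteqP; split=> [a /surj[h [Mh <-]]|_ [h Mh <-]]; first by exists h.
  exact: Msel Mh _ PA.
have MB : (fun h => h B) @` M `<=` B by move=> _ [h Mh <-]; exact: Msel Mh _ PB.
rewrite MA (card_le_trans (card_image_le _ _))//.
rewrite (card_le_trans _ (subset_card_le MB))//.
have /card_eqPle[//] : M #= (fun h => h B) @` M.
rewrite card_eq_sym; apply: inj_card_eq => h k /set_mem Mh /set_mem Mk.
exact: Minj.
Qed.

Definition baire : Type := prod_topology (fun _ : nat => nat).
HB.instance Definition _ := Uniform.on baire.
HB.instance Definition _ := Pointed.on baire.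

Definition cylinder (s : seq nat) : set baire :=
  [set x | forall i, (i < size s)%N -> x i = nth 0%N s i].

Definition borel_baire := g_sigma_algebraType (@open baire).

(* These values determine [mu]; completing it does not change the null ideal,
   since [negligible] sets are the subsets of Borel sets of measure 0. *)
Definition is_baire_lebesgue (R : realType)
    (mu : {measure set borel_baire -> \bar R}) : Prop :=
  forall s : seq nat,
    mu (cylinder s) = (\prod_(i < size s) (2^-1) ^+ (nth 0%N s i).+1)%:E.

Definition null_ideal (R : realType)
    (mu : {measure set borel_baire -> \bar R}) : set (set baire) :=
  [set N : set borel_baire | mu.-negligible N].

Definition nowhere_dense (T : topologicalType) (A : set T) : Prop :=
  interior (closure A) = set0.

Definition meager_ideal : set (set baire) :=
  [set A | exists F : nat -> set baire,
     (forall n, nowhere_dense (F n)) /\ A `<=` \bigcup_n F n].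

Definition add_ideal (I : set (set baire)) : set (set baire) :=
  min_size [set F | F `<=` I /\ ~ I (\bigcup_(A in F) A)].

Definition cof_ideal (I : set (set baire)) : set (set baire) :=
  min_size [set B | B `<=` I /\
                    forall A, I A -> exists2 C, B C & A `<=` C].

Definition slalom : Type :=
  {s : nat -> {fset nat} | forall n, (#|` s n| <= n)%N}.

Definition le_star (x y : baire) : Prop := \forall n \near \oo, (x n <= y n)%N.

Definition neq_star (x y : baire) : Prop := \forall n \near \oo, x n <> y n.

Definition in_star (x : baire) (s : slalom) : Prop :=
  \forall n \near \oo, x n \in sval s n.

Definition rel_mod (I : set (set baire)) (Y : Type) (R : baire -> Y -> Prop)
    (f : baire -> baire) (g : baire -> Y) : Prop :=
  I [set x | ~ R (f x) (g x)].

Definition bnum (I : set (set baire)) (Y : Type) (R : baire -> Y -> Prop) :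
    set (baire -> baire) :=
  min_size [set A | ~ exists g : baire -> Y, forall f, A f -> rel_mod I R f g].

Definition dnum (I : set (set baire)) (Y : Type) (R : baire -> Y -> Prop) :
    set (baire -> Y) :=
  min_size [set A | forall g : baire -> baire,
                      exists2 f, A f & rel_mod I R g f].

(* Main.v *)
Require Import Defs.
From mathcomp Require Import all_boot all_order all_algebra finmap.
From mathcomp Require Import all_classical all_reals all_analysis.
From mathcomp Require Import wochoice zify ring lra.

(* Under add(N) = cof(N) = kappa there is a bijection h of the Baire space with
   h^-1[E] null iff E meager (Erdos-Sierpinski), and f |-> f o h then carries the
   N-versions of the cardinals to the M-versions.  Such an h exists as soon as
   both ideals have increasing cofinal chains of length kappa, all of whose
   blocks have the size of the whole space: match the blocks.

   For N the chain comes from a cofinal family enumerated in order type kappa.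
   For M it is transported along a Tukey map M -> N (Bartoszynski,
   Raisonnier-Stern), in two steps through slaloms of some fixed width h(n).
   (1) A meager set, avoided by dense open sets E_n, is coded by choosing
   finite unions V_n of cylinders inside E_n from a countable stock in which any
   h(n) members meet inside each of the first n cylinders; a slalom containing
   the code yields a dense G_delta set avoiding the meager set.
   (2) x is sent to the null set of the y with y(<n, x(n)>) = n for infinitely
   many n.  If it is included in a null set B, take a closed K of positive
   measure disjoint from B: by a Baire category argument inside K some cylinder
   s meets K in positive measure and K & s misses {y | y(<n, x(n)>) = n} almost
   surely for large n.  For fixed s and n independence bounds the number of such
   values x(n).

   The blocks are made large by Cantor schemes in the complement of a null or
   meager set, whose sets of branches are both null and meager. *)

Set Implicit Arguments.
Unset Strict Implicit.
Unset Printing Implicit Defensive.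

Import choice Order.TTheory GRing.Theory Num.Theory.
Import numFieldNormedType.Exports.

Local Open Scope classical_set_scope.
Local Open Scope card_scope.
Local Open Scope ring_scope.

(** * Cylinders *)

Section cylinders.
Implicit Types (s t : seq nat) (x y : baire) (A : set baire).

Definition base_point s : baire := nth 0%N s.

Lemma cylinder_base s : cylinder s (base_point s).
Proof. by []. Qed.
Arguments cylinder_base : clear implicits.

Lemma cylinder_nth s t i :
  cylinder t `<=` cylinder s -> (i < size s)%N -> nth 0%N t i = nth 0%N s i.
Proof. by move=> ts; apply: (ts (base_point t) (cylinder_base t)). Qed.

Lemma cylinder_mkseq x n : cylinder (mkseq x n) x.
Proof. by move=> i; rewrite size_mkseq => ni; rewrite nth_mkseq. Qed.

Lemma cylinderE s x : cylinder s x -> s = mkseq x (size s).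
Proof.
move=> sx; apply: (@eq_from_nth _ 0%N) => [|i si]; first by rewrite size_mkseq.
by rewrite nth_mkseq// sx.
Qed.

Lemma sub_cylinder s t x : (size s <= size t)%N ->
  cylinder s x -> cylinder t x -> cylinder t `<=` cylinder s.
Proof.
move=> st sx tx y ty i si; have ti := leq_trans si st.
by rewrite (ty _ ti) -(tx _ ti); apply: sx.
Qed.

Lemma cylinder_nil : cylinder [::] = setT.
Proof. by apply/seteqP; split=> // x _ i. Qed.

Lemma cylinder_rcons s n :
  cylinder (rcons s n) = cylinder s `&` [set y | y (size s) = n].
Proof.
apply/seteqP; split=> [y sy|y [sy yn] i].
  split=> [i si|]; last by rewrite /= sy ?size_rcons// nth_rcons ltnn eqxx.
  by rewrite sy ?size_rcons ?(leqW si)// nth_rcons si.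
rewrite size_rcons ltnS leq_eqVlt nth_rcons => /predU1P[->|si].
  by rewrite ltnn eqxx.
by rewrite si; apply: sy.
Qed.

Lemma open_coord i n : open [set x : baire | x i = n].
Proof.
have ci := @proj_continuous nat (fun _ => nat) i.
apply: (@open_comp baire nat (fun x => x i) [set n]); last exact: discrete_open.
by move=> x _; exact: ci.
Qed.

Lemma open_cylinder s : open (cylinder s).
Proof.
elim/last_ind: s => [|s n IHs]; first by rewrite cylinder_nil; exact: openT.
by rewrite cylinder_rcons; apply: openI => //; exact: open_coord.
Qed.

(** The product topology is a supremum, so it suffices that the filter generated by the cylinders
    around [x] converges in each coordinate. *)
Lemma nbhs_cylinder x A : nbhs x A -> exists n, cylinder (mkseq x n) `<=` A.
Proof.
pose F := filter_from [set: nat] (fun n => cylinder (mkseq x n)).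
have FF : Filter F.
  apply: filter_from_filter => [|i j _ _]; first by exists 0%N.
  by exists (maxn i j) => // y xy; split; apply: (@sub_cylinder _ _ x) xy;
    rewrite ?size_mkseq ?leq_maxl ?leq_maxr//; exact: cylinder_mkseq.
have Fx : F --> x.
  apply/cvg_sup => i; apply/cvg_image.
    by apply/seteqP; split=> // n _; exists (fun=> n).
  move=> B /= /nbhs_singleton Bx.
  exists [set y : baire | B (y i)].
    exists i.+1 => // y /(_ i); rewrite size_mkseq ltnSn nth_mkseq// => /(_ isT).
    by move=> /= ->.
  by apply/seteqP; split=> [_ [y /= By <-]//|n Bn]; exists (fun=> n).
by move=> /Fx[n _ nA]; exists n.
Qed.

Lemma closed_cylinder s : closed (cylinder s).
Proof.
move=> x /(_ (cylinder (mkseq x (size s))))[|y [sy xy] i si].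
  by apply: open_nbhs_nbhs; split; [exact: open_cylinder|exact: cylinder_mkseq].
by rewrite -sy// xy ?size_mkseq// nth_mkseq.
Qed.

Lemma closed_limit (K : set baire) x : closed K ->
  (forall n, exists t, [/\ (n <= size t)%N, cylinder t x & cylinder t `&` K !=set0]) ->
  K x.
Proof.
move=> cK xK; apply: cK => B /nbhs_cylinder[n nB].
have [t [nt tx [y [ty Ky]]]] := xK n; exists y; split=> //; apply: nB.
apply: (@sub_cylinder _ _ x) ty => //; first by rewrite size_mkseq.
exact: cylinder_mkseq.
Qed.

Lemma cylinder_chain (c : nat -> seq nat) :
  (forall i, cylinder (c i.+1) `<=` cylinder (c i)) -> (forall i, (i <= size (c i))%N) ->
  exists x, forall i, cylinder (c i) x.
Proof.
move=> cS csz.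
have cle i j : (i <= j)%N -> cylinder (c j) `<=` cylinder (c i).
  by move=> /subnK<-; elim: (j - i)%N => // m IH; apply: subset_trans (cS _) IH.
(* The length bound gives [c j.+1] more than [j] entries, so the default [0] is never read. *)
exists (fun j => nth 0%N (c j.+1) j) => i j ji.
have [ij|/ltnW ij] := leqP i j.+1; first by rewrite (cylinder_nth (cle _ _ ij)).
by rewrite (cylinder_nth (cle _ _ ij)).
Qed.

Lemma nowhere_denseP (F : set baire) : nowhere_dense F <->
  forall s, exists2 t, cylinder t `<=` cylinder s & cylinder t `&` F = set0.
Proof.
split=> [ndF s|ndF].
  have /existsNP[y /not_implyP[sy nFy]] : ~ (cylinder s `<=` closure F).
    move=> sF; have : interior (closure F) (base_point s).
      apply: filterS sF _; apply: open_nbhs_nbhs; split; first exact: open_cylinder.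
      exact: cylinder_base.
    by rewrite ndF.
  have /existsNP[B /not_implyP[yB FB0]] := nFy.
  have [n nB] := nbhs_cylinder yB.
  exists (mkseq y (maxn n (size s))).
    by apply: (@sub_cylinder _ _ y) => //; rewrite ?size_mkseq ?leq_maxr//; exact: cylinder_mkseq.
  apply/seteqP; split=> // z [zy Fz]; apply: FB0; exists z; split=> //.
  apply: nB; apply: (@sub_cylinder _ _ y) zy; rewrite ?size_mkseq ?leq_maxl//;
    exact: cylinder_mkseq.
apply/seteqP; split=> // y /nbhs_cylinder[n yn].
have [t ty t0] := ndF (mkseq y n).
have [|z [Fz tz]] := yn _ (ty _ (cylinder_base t)) (cylinder t).
  by apply: open_nbhs_nbhs; split; [exact: open_cylinder|exact: cylinder_base].
by have : (cylinder t `&` F) z by []; rewrite t0.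
Qed.

End cylinders.
Arguments cylinder_base : clear implicits.

(** * Meager sets and slaloms *)

Definition sqn (i : nat) : seq nat := odflt [::] (unpickle i).

Lemma sqnK s : sqn (pickle s) = s.
Proof. by rewrite /sqn pickleK. Qed.

(* [wide h n V] is the combinatorial content of "every [h] such sets of
   cylinders have unions with a common cylinder inside each of the first [n]
   cylinders". *)
Definition wide (h n : nat) (V : seq (seq nat)) := exists k : nat -> nat,
  (n <= k 0)%N /\ forall j s, (j < h)%N -> (pickle s < k j)%N ->
    exists2 t, t \in V & cylinder t `<=` cylinder s /\ (pickle t < k j.+1)%N.

(** Refine every [s] to some [e s] in [E], and let the stages grow so fast that the refinements of
    all cylinders coded below [k j] are coded below [k j.+1]; the refinements of those below [k h]
    form [V]. *)
Lemma wide_inside (E : set (seq nat)) (h n : nat) :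
  (forall s, exists2 t, cylinder t `<=` cylinder s & E t) ->
  exists2 V, wide h n V & forall t, t \in V -> E t.
Proof.
move=> dE; have /choice[e eP] : forall s, exists t,
  cylinder t `<=` cylinder s /\ E t by move=> s; have [t ? ?] := dE s; exists t.
pose next m := (m + \sum_(i < m) (pickle (e (sqn i))).+1)%N.
pose k j := iter j next n.
have kS j : (k j <= k j.+1)%N by rewrite /k /= /next leq_addr.
have kle i j : (i <= j)%N -> (k i <= k j)%N.
  move=> /subnK<-; elim: (j - i)%N => // m IH.
  exact: leq_trans IH (kS _).
exists [seq e (sqn i) | i <- iota 0 (k h)] => [|_ /mapP[i _ ->]]; last first.
  by have [] := eP (sqn i).
exists k; split=> // j s jh sj; exists (e s).
  apply/mapP; exists (pickle s); last by rewrite sqnK.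
  by rewrite mem_iota add0n (leq_trans sj)// kle// ltnW.
split; first by have [] := eP s.
rewrite /k /= -/(k j) /next (bigD1 (Ordinal sj))//= sqnK.
by rewrite addnCA addSn ltnS leq_addr.
Qed.

Lemma seq_min (T : eqType) (g : T -> nat) (L : seq T) : L != [::] ->
  exists2 x, x \in L & forall y, y \in L -> (g x <= g y)%N.
Proof.
elim: L => // x [|y L] IH _.
  by exists x; [rewrite inE|move=> z; rewrite inE => /eqP->].
have [//|z zL zmin] := IH.
have [xz|zx] := leqP (g x) (g z).
  exists x; first exact: mem_head.
  by move=> w; rewrite inE => /predU1P[->//|/zmin]; apply: leq_trans.
exists z; first by rewrite inE zL orbT.
by move=> w; rewrite inE => /predU1P[->|/zmin//]; apply: ltnW.
Qed.

(* The set whose next stage [k V j.+1] is smallest is treated first: the cylinder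
   it provides is then early enough for all the others. *)
Lemma wide_meet (h n : nat) (L : seq (seq (seq nat))) s :
  (size L <= h)%N -> (forall V, V \in L -> wide h n V) -> (pickle s < n)%N ->
  exists2 t, cylinder t `<=` cylinder s &
    forall V, V \in L -> exists2 u, u \in V & cylinder t `<=` cylinder u.
Proof.
move=> Lh wL sn.
have /choice[k kP] : forall V, exists k : nat -> nat, V \in L ->
    (n <= k 0)%N /\ forall j s, (j < h)%N -> (pickle s < k j)%N ->
    exists2 t, t \in V & cylinder t `<=` cylinder s /\ (pickle t < k j.+1)%N.
  move=> V; have [/wL[k kV]|nVL] := boolP (V \in L); first by exists k.
  by exists id.
(* [j] sets are already treated and [m] remain; the code of the current cylinder stays below stage
   [j] of every remaining set. *)
suff H m : forall L' j s', size L' = m -> (j + m <= h)%N ->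
    {subset L' <= L} -> (forall V, V \in L' -> (pickle s' < k V j)%N) ->
    exists2 t, cylinder t `<=` cylinder s' &
    forall V, V \in L' -> exists2 u, u \in V & cylinder t `<=` cylinder u.
  apply: (H (size L) L 0%N) => // V VL.
  by have [nk _] := kP _ VL; apply: leq_trans nk.
elim: m => [|m IHm] L' j s' L'm jh L'L sk.
  by exists s' => // V; rewrite (size0nil L'm).
have [|V VL' Vmin] := @seq_min _ (fun V => k V j.+1) L'; first by case: L' L'm {L'L sk}.
have [_ /(_ j s')] := kP _ (L'L _ VL').
case=> [||u uV [us' uk]]; [by apply: leq_trans jh; rewrite addnS ltnS leq_addr|exact: sk|].
have [|||W /mem_rem WL'|t tu tP] := IHm (rem V L') j.+1 u.
- by rewrite size_rem// L'm.
- by rewrite addSnnS.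
- by move=> W /mem_rem/L'L.
- by apply: leq_trans uk _; apply: Vmin.
exists t; first exact: subset_trans us'.
move=> W; have [-> _|WV] := eqVneq W V; first by exists u.
by move=> WL'; apply: tP; rewrite rem_mem.
Qed.

Lemma nowhere_dense_finU (F : nat -> set baire) :
  (forall n, nowhere_dense (F n)) -> forall n s,
  exists2 t, cylinder t `<=` cylinder s &
    forall i, (i <= n)%N -> cylinder t `&` F i = set0.
Proof.
move=> /(_ _)/nowhere_denseP ndF; elim=> [|n IHn] s.
  have [t ts t0] := ndF 0%N s; exists t => // i.
  by rewrite leqn0 => /eqP ->.
have [t ts tP] := IHn s; have [u ut u0] := ndF n.+1 t.
exists u; first exact: subset_trans ts.
move=> i; rewrite leq_eqVlt => /predU1P[->//|/tP ti].
by rewrite -subset0; rewrite -ti; exact: setSI.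
Qed.

Definition eventually_in (x : nat -> nat) (S : nat -> seq nat) :=
  exists n0, forall n, (n0 <= n)%N -> x n \in S n.

Definition sqsqn (i : nat) : seq (seq nat) := odflt [::] (unpickle i).

(** The complement consists of the points that, for infinitely many [n], lie in the union of every
    wide set coded in [S n]. *)
Definition slalom_meager (h : nat -> nat) (S : nat -> seq nat) : set baire :=
  [set x | exists k, forall n, (k <= n)%N -> ~ forall i, i \in S n ->
     wide (h n) n (sqsqn i) -> exists2 t, t \in sqsqn i & cylinder t x].

(** For fixed [k], one [n] beyond both [k] and the code of [s] suffices: [wide_meet] refines [s] to
    a cylinder inside the union of every wide set coded in [S n]. *)
Lemma slalom_meagerP (h : nat -> nat) (S : nat -> seq nat) :
  (forall n, (size (S n) <= h n)%N) -> meager_ideal (slalom_meager h S).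
Proof.
move=> Sh; exists (fun k => [set x | forall n, (k <= n)%N -> ~ forall i, i \in S n ->
     wide (h n) n (sqsqn i) -> exists2 t, t \in sqsqn i & cylinder t x]); split.
  move=> k; apply/nowhere_denseP => s.
  pose n := maxn k (pickle s).+1.
  pose L := [seq sqsqn i | i <- S n & `[< wide (h n) n (sqsqn i) >]].
  have [|V||t ts tP] := @wide_meet (h n) n L s.
  - by rewrite size_map size_filter (leq_trans (count_size _ _)).
  - by case/mapP => i; rewrite mem_filter => /andP[/asboolP ? _ ->].
  - by rewrite leq_maxr.
  exists t => //; apply/seteqP; split=> // x [tx /(_ n)].
  rewrite leq_maxl => /(_ isT); apply => i iS iw.
  have [|u ui tu] := tP (sqsqn i).
    by apply/mapP; exists i => //; rewrite mem_filter iS andbT; apply/asboolP.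
  by exists u => //; apply: tu.
by move=> x [k kP]; exists k.
Qed.

(** [f A] codes sets [V n] of cylinders that avoid the first [n.+1] of the nowhere dense sets
    covering [A]. A point of [A] lies in one of these, so it misses [V n] for all large [n], where
    [S] also captures the code of [V n]. *)
Lemma meager_localization (h : nat -> nat) : exists f : set baire -> nat -> nat,
  forall A S, meager_ideal A -> eventually_in (f A) S -> A `<=` slalom_meager h S.
Proof.
suff : forall A, exists f : nat -> nat, forall S, meager_ideal A ->
    eventually_in f S -> A `<=` slalom_meager h S.
  by move=> /choice[f fP]; exists f => A S; apply: fP.
move=> A; have [[F [ndF AF]]|nA] := pselect (meager_ideal A); last by exists id.
have /choice[V VP] : forall n, exists V, wide (h n) n V /\
    forall t, t \in V -> forall i, (i <= n)%N -> cylinder t `&` F i = set0.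
  move=> n; have [V Vw VF] := wide_inside (h n) n (nowhere_dense_finU ndF n).
  by exists V.
exists (fun n => pickle (V n)) => S _ [n0 n0P] x /AF[i _ Fix].
exists (maxn i n0) => n; rewrite geq_max => /andP[ni nn0].
move=> /(_ _ (n0P _ nn0)); rewrite /sqsqn pickleK /= => /(_ (VP n).1)[t tV tx].
have ti0 := (VP n).2 _ tV _ ni.
by have : (cylinder t `&` F i) x by []; rewrite ti0.
Qed.

(** * Regularity of the measure *)

Section baire_measure.
Variables (R : realType) (mu : {measure set borel_baire -> \bar R}).
Hypothesis mu_leb : is_baire_lebesgue mu.
Implicit Types (s t : seq nat) (A K : set borel_baire).

Lemma open_borel (A : set baire) : open A -> measurable (A : set borel_baire).
Proof. by move=> oA; apply: sub_sigma_algebra. Qed.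

Lemma closed_borel (A : set baire) : closed A -> measurable (A : set borel_baire).
Proof.
move=> cA; rewrite -(setCK A); apply: measurableC; apply: open_borel.
exact: closed_openC.
Qed.

Lemma measurable_cylinder s : measurable (cylinder s : set borel_baire).
Proof. by apply: open_borel; exact: open_cylinder. Qed.

Lemma mu_setT : mu setT = 1%E.
Proof. by have := mu_leb [::]; rewrite cylinder_nil big_ord0. Qed.

Lemma mu_fin A : measurable A -> (mu A < +oo)%E.
Proof.
move=> mA; apply: (@le_lt_trans _ _ (mu setT)); last by rewrite mu_setT ltry.
by apply: le_measure; rewrite ?inE.
Qed.

Lemma mu_cylinder_rcons s n :
  mu (cylinder (rcons s n)) = (mu (cylinder s) * ((2^-1) ^+ n.+1)%:E)%E.
Proof.
rewrite (mu_leb (rcons _ _)) (mu_leb s) size_rcons big_ord_recr/= -EFinM.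
rewrite nth_rcons ltnn eqxx; congr ((_ * _)%:E); apply: eq_bigr => i _.
by rewrite nth_rcons ltn_ord.
Qed.

Lemma mu_cylinder_le s : (mu (cylinder s) <= ((2^-1) ^+ size s)%:E)%E.
Proof.
rewrite mu_leb lee_fin -[X in _ <= _ ^+ X]card_ord -prodr_const.
apply: ler_prod => i _; rewrite exprn_ge0 ?invr_ge0//= exprS ler_piMr ?invr_ge0//.
by rewrite exprn_ile1 ?invr_ge0// invf_le1 ?ler1n.
Qed.

Lemma mu_nondecreasing_near (G : nat -> set borel_baire) (e : R) :
  (forall n, measurable (G n)) -> {homo G : m n / (m <= n)%N >-> m `<=` n} ->
  0 < e -> exists n, (mu ((\bigcup_n G n) `\` G n) < e%:E)%E.
Proof.
move=> mG Ghomo e0.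
have mD n : measurable ((\bigcup_n G n) `\` G n).
  by apply: measurableD => //; exact: bigcupT_measurable.
have : mu ((\bigcup_n G n) `\` G n) @[n --> \oo] -->
    mu (\bigcap_n ((\bigcup_n G n) `\` G n)).
  apply: nonincreasing_cvg_mu => //; first exact: mu_fin.
    exact: bigcapT_measurable.
  by move=> m n mn; apply/subsetPset => x [Gx nGx]; split=> // /(Ghomo _ _ mn).
have -> : \bigcap_n ((\bigcup_n G n) `\` G n) = set0.
  apply/seteqP; split=> // x xG; have [[n _ Gnx] _] := xG 0%N I.
  by have [_] := xG n I.
rewrite measure0 => /fine_cvgP[_ /cvgr_lt /(_ _ e0)].
move=> [n _ /(_ n (leqnn n))] /= ne; exists n.
rewrite -[X in (X < _)%E]fineK ?lte_fin// ge0_fin_numE//; exact: mu_fin.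
Qed.

(** The sets with such approximations form a sigma-algebra containing the open sets; complements
    exchange the roles of [U] and [F]. *)
Lemma borel_regular A (e : R) : measurable A -> 0 < e ->
  exists U F : set baire, [/\ open U, closed F, F `<=` A, A `<=` U &
    (mu (U `\` F) < e%:E)%E].
Proof.
move=> mA; move: A mA e.
apply: smallest_sub => [|A oA e e0]; last first.
  (* An open set is the increasing union of these clopen sets, which serve as its inner
     approximations. *)
  pose G n := [set x | exists2 i, (i <= n)%N &
    cylinder (sqn i) x /\ cylinder (sqn i) `<=` A].
  have clG n : clopen (G n).
    pose C i := [set x | cylinder (sqn i) x /\ cylinder (sqn i) `<=` A].
    have -> : G n = \bigcup_(i in `I_n.+1) C i by apply/seteqP; split=> x [i]; exists i.
    have clC i : clopen (C i).
      have [iA|niA] := pselect (cylinder (sqn i) `<=` A).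
        have -> : C i = cylinder (sqn i) by apply/seteqP; split=> [x []|x xi].
        by split; [exact: open_cylinder|exact: closed_cylinder].
      suff -> : C i = set0 by exact: clopen0.
      by apply/seteqP; split=> x // [].
    split; first by apply: bigcup_open => i _; have [] := clC i.
    by apply: closed_bigcup => [|i _]; [exact: finite_II|have [] := clC i].
  have UG : \bigcup_n G n = A.
    apply/seteqP; split=> [x [n _ [i _ [xi]]]|x Ax]; first exact.
    have [n nA] := nbhs_cylinder (open_nbhs_nbhs (conj oA Ax)).
    exists (pickle (mkseq x n)) => //; exists (pickle (mkseq x n)) => //.
    by rewrite sqnK; split=> //; exact: cylinder_mkseq.
  have [||n] := @mu_nondecreasing_near G e _ _ e0.
  - by move=> n; apply: open_borel; have [] := clG n.
  - by move=> m n mn x [i im xi]; exists i => //; apply: leq_trans mn.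
  rewrite UG => ne; exists A, (G n); split=> //; first by have [] := clG n.
  by rewrite -UG; apply: bigcup_sup.
split.
- move=> e e0; exists set0, set0; split=> //; [exact: open0|exact: closed0|].
  by rewrite setD0 measure0.
- move=> A IA e e0; have [U [F [oU cF FA AU UF]]] := IA _ e0.
  exists (~` F), (~` U); split.
  + exact: closed_openC.
  + exact: open_closedC.
  + by rewrite setTD; apply: subsetC.
  + by rewrite setTD; apply: subsetC.
  + by rewrite setDE setCK setIC -setDE.
move=> A IA e e0.
have e20 : 0 < e / 2 by rewrite divr_gt0.
have /choice[UF UFP] : forall n, exists UF : set baire * set baire,
    [/\ open UF.1, closed UF.2, UF.2 `<=` A n, A n `<=` UF.1 &
    (mu (UF.1 `\` UF.2) < (e / 2 / (2 ^ n.+1)%:R)%:E)%E].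
  move=> n; have [|U [F UFn]] := IA n (e / 2 / (2 ^ n.+1)%:R).
    by rewrite divr_gt0// ltr0n expn_gt0.
  by exists (U, F).
pose U n := (UF n).1; pose F n := (UF n).2.
(* Only finitely many [F i] are joined, to keep the union closed; half of [e] pays for the tail, the
   other half for the gaps between [U n] and [F n]. *)
pose G n := \bigcup_(i in `I_n.+1) F i.
have clG n : closed (G n).
  apply: closed_bigcup; first exact: finite_II.
  by move=> i _; have [] := UFP i.
have mF n : measurable (F n : set borel_baire).
  by apply: closed_borel; have [] := UFP n.
have mU n : measurable (U n : set borel_baire) by apply: open_borel; have [] := UFP n.
have mG n : measurable (G n : set borel_baire).
  by rewrite -(setCK (G n)); apply: measurableC; apply: open_borel; exact: closed_openC.
have UG : \bigcup_n G n = \bigcup_n F n.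
  apply/seteqP; split=> [x [n _ [i _ Fx]]|x [n _ Fx]]; first by exists i.
  by exists n => //; exists n => //=.
have [|n] := @mu_nondecreasing_near G (e / 2) mG _ e20.
  by move=> m n mn x [i /= im xi]; exists i => //=; apply: leq_trans mn.
rewrite UG => nG; exists (\bigcup_n U n), (G n); split=> //.
- by apply: bigcup_open => i _; have [] := UFP i.
- by move=> x [i _ Fx]; exists i => //; have [_ _ + _ _] := UFP i; apply.
- by apply: subset_bigcup => i _; have [] := UFP i.
have mUF : measurable (\bigcup_n (U n `\` F n) : set borel_baire).
  by apply: bigcupT_measurable => i; apply: measurableD.
apply: (@le_lt_trans _ _ (mu (\bigcup_n (U n `\` F n)) + mu (\bigcup_n F n `\` G n))%E).
  apply: le_trans (measureU2 _ _ _) => //.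
    apply: le_measure; rewrite ?inE.
    - by apply: measurableD => //; exact: bigcupT_measurable.
    - apply: measurableU => //; apply: measurableD => //.
      exact: bigcupT_measurable.
    move=> x [[i _ Ux] nGx]; have [[j _ Fx]|nFx] := pselect ((\bigcup_n F n) x).
      by right; split=> //; exists j.
    by left; exists i => //; split=> // Fx; apply: nFx; exists i.
  by apply: measurableD => //; exact: bigcupT_measurable.
rewrite [e]splitr EFinD lee_ltD//.
  by rewrite ge0_fin_numE//; exact: mu_fin.
apply: (@le_trans _ _ (\sum_(i <oo) mu (U i `\` F i))%E).
  apply: measure_sigma_subadditive => //.
  by move=> i; apply: measurableD.
apply: le_trans (epsilon_trick0 xpredT (ltW e20)).
apply: lee_nneseries => // i _; apply: ltW.
by have [] := UFP i.
Qed.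
End baire_measure.

(** * Closed sets off null sets, and independence of coordinates *)

Section avoiding.
Variables (R : realType) (mu : {measure set borel_baire -> \bar R}).
Hypothesis mu_leb : is_baire_lebesgue mu.
Implicit Types (s t : seq nat) (A K : set borel_baire).

(** Regularity gives an open set of measure below 1 around the null set; its complement is the
    required [K]. *)
Lemma null_closed_disjoint A : mu.-negligible A ->
  exists K : set baire, [/\ closed K, (0 < mu K)%E & K `&` A = set0].
Proof.
move=> [B [mB B0 AB]].
have [U [F [oU cF FB BU UF]]] := borel_regular mu_leb mB (ltr01 : 0 < 1 :> R).
have mU : measurable (U : set borel_baire) by exact: open_borel.
have mF : measurable (F : set borel_baire) by exact: closed_borel.
have U1 : (mu U < 1)%E.
  apply: le_lt_trans UF; have {1}-> : U = F `|` (U `\` F) by rewrite setDUK//; exact: subset_trans FB BU.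
  have mUF : measurable (U `\` F : set borel_baire) by exact: measurableD.
  apply: le_trans (measureU2 mu mF mUF) _.
  rewrite [X in (X + _)%E](_ : _ = 0%E) ?add0e//.
  exact: subset_measure0 B0.
exists (~` U); split; first exact: open_closedC.
  rewrite -setTD measureD//= ?setTI ?(mu_setT mu_leb) ?ltry//.
  by rewrite sube_gt0.
by apply/seteqP; split=> // x [nUx Ax]; apply/nUx/BU/AB.
Qed.

Definition determined (p : nat) (A : set borel_baire) :=
  forall x y : baire, (forall i, (i < p)%N -> x i = y i) -> A x -> A y.

(** The condition [pickle (sqn i) = i] makes the indexing injective, so that the union is disjoint
    and measures can be summed. *)
Lemma determined_bigcup p A : determined p A ->
  A = \bigcup_(i in [set i | [/\ pickle (sqn i) = i, size (sqn i) = p &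
    A (base_point (sqn i))]]) cylinder (sqn i).
Proof.
move=> dA; apply/seteqP; split=> [x Ax|x [i [_ ip Ai] xi]].
  exists (pickle (mkseq x p)); rewrite /= ?sqnK ?size_mkseq; last exact: cylinder_mkseq.
  by split=> //; apply: dA Ax => i ip; rewrite /base_point nth_mkseq.
by apply: dA Ai => j jp; rewrite xi ?ip.
Qed.

Lemma measurable_determined p A : determined p A -> measurable A.
Proof.
move=> /determined_bigcup->; apply: bigcup_measurable => i _.
exact: measurable_cylinder.
Qed.

(** Coordinate [p] is independent of the earlier ones: the product formula shows this on each
    cylinder of length [p], and [A] is a disjoint union of these. *)
Lemma mu_coord p A n : determined p A ->
  mu (A `&` [set y : baire | y p = n]) = (((2^-1) ^+ n.+1)%:E * mu A)%E.
Proof.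
move=> /determined_bigcup ->; set D := [set i | _].
have tD : trivIset D (fun i => cylinder (sqn i) : set borel_baire).
  move=> i j [ip isz _] [jp jsz _] [x [xi xj]].
  by rewrite -ip -jp (cylinderE xi) (cylinderE xj) isz jsz.
rewrite setI_bigcupl measure_bigcup; first last.
- by move=> i j Di Dj [x [[xi _] [xj _]]]; apply: tD => //; exists x.
- move=> i _; apply: measurableI; first exact: measurable_cylinder.
  by apply: open_borel; exact: open_coord.
rewrite measure_bigcup//; last by move=> i _; exact: measurable_cylinder.
rewrite -nneseriesZl//.
apply: eq_eseriesr => i /set_mem[_ <- _].
by rewrite -cylinder_rcons mu_cylinder_rcons// muleC.
Qed.

Lemma mu_coordC p A n : determined p A ->
  mu (A `&` [set y : baire | y p <> n]) = ((1 - (2^-1) ^+ n.+1)%:E * mu A)%E.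
Proof.
move=> dA; have mA := measurable_determined dA.
have -> : A `&` [set y : baire | y p <> n] = A `\` [set y : baire | y p = n] by [].
have mp : measurable ([set y : baire | y p = n] : set borel_baire).
  by apply: open_borel; exact: open_coord.
have Afin : mu A \is a fin_num by rewrite ge0_fin_numE//; exact: (mu_fin mu_leb).
transitivity (mu A - mu (A `&` [set y : baire | y p = n]))%E.
  by apply: measureD => //; exact: (mu_fin mu_leb).
rewrite mu_coord// -(fineK Afin) -!EFinM -EFinB.
by rewrite mulrBl mul1r.
Qed.

Lemma mu_avoid n (P : seq nat) : uniq P ->
  mu [set y : baire | forall p, p \in P -> y p <> n] =
  ((1 - (2^-1) ^+ n.+1) ^+ size P)%:E.
Proof.
(* Dropping the constraints at positions [q] and above leaves a set determined by the first [q]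
   coordinates, so induction on [q] multiplies in one independent factor at a time. *)
move=> uP; pose D q := [set y : borel_baire | forall p, p \in P -> (p < q)%N -> (y : baire) p <> n].
have dD q : determined q (D q).
  by move=> x y xy Dx p pP pq; rewrite -xy//; apply: Dx.
suff H q : mu (D q) = ((1 - (2^-1) ^+ n.+1) ^+ count (fun p => p < q)%N P)%:E.
  pose q := (\max_(p <- P) p).+1.
  have Pq p : p \in P -> (p < q)%N by move=> pP; rewrite ltnS; exact: leq_bigmax_seq.
  have := H q; rewrite (_ : D q = [set y : baire | forall p, p \in P -> y p <> n]); last first.
    by apply/seteqP; split=> y yP p pP; [apply: yP (Pq _ pP)|move=> _; exact: yP].
  move=> ->; congr ((_ ^+ _)%:E); apply/eqP; rewrite -all_count.
  by apply/allP.
elim: q => [|q IH].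
  rewrite (_ : D 0%N = setT); last by apply/seteqP; split=> // y _ p _.
  by rewrite (mu_setT mu_leb) (eq_count (a2 := pred0))// count_pred0 expr0.
have cq : count (fun p => p < q.+1)%N P = (count (fun p => p < q)%N P + (q \in P))%N.
  rewrite -(count_uniq_mem _ uP) -(@count_predUI _ (fun p => p < q)%N).
  rewrite [X in (_ + X)%N](_ : _ = 0%N) ?addn0; last first.
    apply/eqP; rewrite -leqn0 leqNgt -has_count; apply/hasPn => p _ /=.
    by apply/negP => /andP[+ /eqP pq]; rewrite pq ltnn.
  by apply: eq_count => p /=; rewrite ltnS leq_eqVlt orbC.
have [qP|nqP] := boolP (q \in P); last first.
  rewrite cq (negbTE nqP) addn0 -IH; congr (mu _); apply/seteqP; split=> y yP p pP pq.
    by apply: yP => //; exact: ltnW.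
  apply: yP => //; move: pq; rewrite ltnS leq_eqVlt => /predU1P[pq|//].
  by rewrite -pq pP in nqP.
rewrite cq qP addn1 exprS EFinM -IH -(@mu_coordC q)//; congr (mu _).
apply/seteqP; split=> [y yP|y [yP yq] p pP].
  by split=> [p pP pq|]; apply: yP => //; exact: ltnW.
by rewrite ltnS leq_eqVlt => /predU1P[->//|]; exact: yP.
Qed.

End avoiding.

(** * Null sets and slaloms *)

(** A duplicate-free list in [D] of maximal length exhausts [D]. *)
Lemma bounded_enum (D : set nat) (N : nat) :
  (forall L : seq nat, uniq L -> (forall m, m \in L -> D m) -> (size L <= N)%N) ->
  exists2 L : seq nat, (size L <= N)%N & forall m, D m -> m \in L.
Proof.
move=> DN; pose P k := `[< exists L : seq nat, [/\ uniq L, size L = k &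
  forall m, m \in L -> D m] >].
have P0 : exists k, P k by exists 0%N; apply/asboolP; exists [::].
have PN k : P k -> (k <= N)%N by move=> /asboolP[L [uL <- LD]]; exact: DN.
have [k /asboolP[L [uL Lk LD]] kmax] := ex_maxnP P0 PN.
exists L => [|m Dm]; first exact: DN.
apply: contraT => mL; suff : (k.+1 <= k)%N by rewrite ltnn.
apply: kmax; apply/asboolP; exists (m :: L); split=> /=; rewrite ?mL ?Lk//.
by move=> p; rewrite inE => /predU1P[->//|]; exact: LD.
Qed.

(** With [r = 2 ^ - (n + 1)] it comes down to [(1 - r) ^ (1 / r) <= 1 / 2]. Bernoulli's inequality
    for [1 / (1 - r) = 1 + r / (1 - r)] bounds the inverse of the left side below by
    [1 + 1 / (1 - r) >= 2]. *)
Lemma half_pow_le (R : realType) (n c m : nat) : (c * 2 ^ n.+1 <= m)%N ->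
  (1 - (2^-1) ^+ n.+1) ^+ m <= (2^-1) ^+ c :> R.
Proof.
move=> cm; set r : R := 2^-1 ^+ n.+1.
have r1 : 0 < r < 1.
  by rewrite exprn_gt0 ?invr_gt0//= exprn_ilt1 ?invr_ge0// invf_lt1 ?ltr1n.
have s01 : 0 <= 1 - r <= 1 by lra.
apply: (@le_trans _ _ ((1 - r) ^+ (c * 2 ^ n.+1))).
  by apply: ler_wiXn2l cm; lra.
rewrite mulnC exprM; apply: lerXn2r; rewrite ?nnegrE ?exprn_ge0 ?invr_ge0//; first lra.
have bern (k : nat) (x : R) : 0 <= x -> 1 + k%:R * x <= (1 + x) ^+ k.
  move=> x0; elim: k => [|k IH]; first by rewrite mul0r addr0 expr0.
  rewrite exprS -natr1.
  have := ler_wpM2l (_ : 0 <= 1 + x) IH; rewrite addr_ge0// => /(_ isT).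
  apply: le_trans; have : 0 <= k%:R * (x * x) by rewrite mulr_ge0// mulr_ge0.
  lra.
have rE : r * (2 ^ n.+1)%:R = 1.
  by rewrite /r natrX exprVn mulVf// expf_neq0// pnatr_eq0.
have x0 : 0 <= r / (1 - r) by rewrite divr_ge0//; lra.
have := bern (2 ^ n.+1)%N _ x0.
have -> : 1 + r / (1 - r) = (1 - r)^-1 by field; lra.
rewrite mulrA (mulrC _ r) rE mul1r exprVn => H.
have q1 : 1 <= (1 - r)^-1 by rewrite invf_ge1; lra.
have p0 : 0 < (1 - r) ^+ (2 ^ n.+1) by rewrite exprn_gt0//; lra.
rewrite -(invrK ((1 - r) ^+ _)) lef_pV2 ?posrE ?invr_gt0//.
by apply: le_trans H; lra.
Qed.

Section null_localization.
Variables (R : realType) (mu : {measure set borel_baire -> \bar R}).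
Hypothesis mu_leb : is_baire_lebesgue mu.
Implicit Types (s t : seq nat) (A : set borel_baire).

(* For fixed [n] these are independent events of measure [2 ^- n.+1]. *)
Definition spot (n m : nat) : set baire := [set y | y (pickle (n, m)) = n].

Definition spots_io (x : nat -> nat) : set baire := lim_sup_set (fun n => spot n (x n)).

Lemma measurable_spot n m : measurable (spot n m : set borel_baire).
Proof. by apply: open_borel; exact: open_coord. Qed.

(** Borel-Cantelli: the measures [2 ^ - (n + 1)] of the spots are summable. *)
Lemma spots_io_null x : mu.-negligible (spots_io x).
Proof.
exists (spots_io x); split=> //.
  apply: bigcap_measurable => // k _; apply: bigcup_measurable => j _.
  exact: measurable_spot.
apply: lim_sup_set_cvg0 => [k|]; first exact: measurable_spot.
apply: (@le_lt_trans _ _ 1%E); last exact: ltry.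
apply: le_trans (epsilon_trick0 xpredT (ler01 : 0 <= 1 :> R)).
apply: lee_nneseries => // i _.
have := @mu_coord _ _ mu_leb (pickle (i, x i)) setT i; rewrite setTI => ->//.
by rewrite (mu_setT mu_leb) mule1 lee_fin div1r natrX exprVn.
Qed.

Lemma half_pow_lt_mu (A : set borel_baire) : measurable A -> (0 < mu A)%E ->
  exists c : nat, (((2^-1) ^+ c)%:E < mu A)%E.
Proof.
move=> mA A0.
have Afin : mu A \is a fin_num by rewrite ge0_fin_numE//; exact: (mu_fin mu_leb).
have fA : 0 < fine (mu A) by rewrite -lte_fin fineK.
have : (GRing.exp (2^-1) : R^nat) @ \oo --> (0 : R).
  by apply: cvg_expr; rewrite ger0_norm ?invr_ge0// invf_lt1 ?ltr1n.
move=> /cvgr_lt /(_ _ fA)[c _ /(_ c (leqnn c))] /= H; exists c.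
by rewrite -(fineK Afin) lte_fin.
Qed.

Lemma positive_extension A (p : nat) : measurable A -> (0 < mu A)%E ->
  exists2 t, size t = p & (0 < mu (A `&` cylinder t))%E.
Proof.
move=> mA; rewrite measure_gt0 => /eqP A0.
apply: contrapT => nt; apply: A0.
apply: (@measure_negligible _ _ _ mu) => //.
apply: (@negligibleS _ _ _ _ (\bigcup_i (if size (sqn i) == p then A `&` cylinder (sqn i) else set0))).
  move=> x Ax; exists (pickle (mkseq x p)) => //; rewrite sqnK size_mkseq eqxx.
  by split=> //; exact: cylinder_mkseq.
apply: negligible_bigcup => i; case: eqP => [ip|_]; last exact: negligible_set0.
apply/negligibleP; first by apply: measurableI => //; exact: measurable_cylinder.
apply/eqP; apply: contrapT => /negP; rewrite -measure_gt0 => H; apply: nt.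
by exists (sqn i).
Qed.

(** Up to a null set, [A] lies in the set avoiding all the spots listed in [L]. By independence that
    set has measure at most [2 ^ - c < mu A] if [L] exceeds the bound. *)
Lemma positive_spots_bound A : measurable A -> (0 < mu A)%E -> exists c, forall n L,
  uniq L -> (forall m, m \in L -> mu (A `&` spot n m) = 0%E) ->
  (size L <= c * 2 ^ n.+1)%N.
Proof.
move=> mA A0; have [c cA] := half_pow_lt_mu mA A0.
exists c => n L uL LA; rewrite leqNgt; apply/negP => /ltnW Lc.
have : (mu A <= ((2^-1) ^+ c)%:E)%E; last by rewrite leNgt cA.
pose P := [seq pickle (n, m) | m <- L].
have uP : uniq P by rewrite map_inj_uniq// => i j /(pcan_inj pickleK)[].
pose Q := [set y : baire | forall p, p \in P -> y p <> n].
have mQ : measurable (Q : set borel_baire).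
  apply: (@measurable_determined (\max_(p <- P) p).+1) => x y xy Qx p pP.
  by rewrite -xy ?ltnS; [exact: Qx|exact: leq_bigmax_seq].
have := half_pow_le R Lc; rewrite -lee_fin; apply: le_trans.
rewrite -[X in (_ ^+ X)%:E](size_map (fun m => pickle (n, m))) -(mu_avoid mu_leb)//.
rewrite (measureDI mu mA mQ).
rewrite [X in (X + _)%E](_ : _ = 0%E); last first.
  apply: measure_negligible; first exact: measurableD.
  apply: (@negligibleS _ _ _ _ (\bigcup_m (if m \in L then A `&` spot n m else set0))).
    move=> y [Ay nQ]; apply: contrapT => nU; apply: nQ => p /mapP[m mL ->] ynm.
    by apply: nU; exists m => //; rewrite mL.
  apply: negligible_bigcup => m; case: ifPn => [mL|_]; last exact: negligible_set0.
  apply/negligibleP; last exact: LA.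
  by apply: measurableI => //; exact: measurable_spot.
rewrite add0e; apply: le_measure; rewrite ?inE//; exact: measurableI.
Qed.

(** Otherwise every cylinder meeting [K] in positive measure could be refined, keeping positive
    measure, into [spot n (x n)] with [n] arbitrarily large; the limit of such refinements would lie
    in [K] and in [spots_io x]. *)
Lemma positive_spots_null (K : set baire) x : closed K -> (0 < mu K)%E ->
  K `&` spots_io x = set0 -> exists s k, (0 < mu (K `&` cylinder s))%E /\
    forall n, (k <= n)%N -> mu (K `&` cylinder s `&` spot n (x n)) = 0%E.
Proof.
move=> cK K0 Kx; apply: contrapT => nsk.
have mK : measurable (K : set borel_baire) by exact: closed_borel.
have mKs s : measurable (K `&` cylinder s : set borel_baire).
  by apply: measurableI => //; exact: measurable_cylinder.
pose pos s := (0 < mu (K `&` cylinder s))%E.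
have /choice[e eP] : forall ks : nat * seq nat, exists t, pos ks.2 ->
    [/\ pos t, cylinder t `<=` cylinder ks.2, (ks.1 <= size t)%N &
    exists2 n, (ks.1 <= n)%N & cylinder t `<=` spot n (x n)].
  move=> [k s] /=; have [ps|] := pselect (pos s); last by exists [::].
  have [n kn ns] : exists2 n, (k <= n)%N & (0 < mu (K `&` cylinder s `&` spot n (x n)))%E.
    apply: contrapT => nn; apply: nsk; exists s, k; split=> // n kn.
    apply/eqP; apply: contrapT => /negP; rewrite -measure_gt0 => H; apply: nn.
    by exists n.
  (* Length [p] exceeds the coordinate that decides the spot, so a cylinder of this length meeting
     the spot lies inside it. *)
  pose p := maxn k (maxn (size s) (pickle (n, x n)).+1).
  have [|t tp] := @positive_extension _ p _ ns.
    by apply: measurableI => //; exact: measurable_spot.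
  move=> tpos; exists t => _.
  have [y [[[Ky sy] ny] ty]] : (K `&` cylinder s `&` spot n (x n) `&` cylinder t) !=set0.
    by apply/set0P; apply: contraTneq tpos => ->; rewrite measure0 ltxx.
  split.
  - apply: lt_le_trans tpos _; apply: le_measure; rewrite ?inE//.
      apply: measurableI; last exact: measurable_cylinder.
      by apply: measurableI => //; exact: measurable_spot.
    by move=> z [[[Kz _] _] tz].
  - by apply: (sub_cylinder _ sy ty); rewrite tp /p; lia.
  - by rewrite tp leq_maxl.
  exists n => // z tz.
  have nt : (pickle (n, x n) < size t)%N by rewrite tp /p; lia.
  by rewrite /spot /= tz// -ty.
pose fix c i := if i is j.+1 then e (j, c j) else [::].
have cpos i : pos (c i).
  elim: i => [|i /(eP (i, c i))[]//]; by rewrite /pos /= cylinder_nil setIT.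
(* [c i.+1] is only known to have length at least [i], hence the shift. *)
pose d i := c i.+1.
have [z zP] : exists z, forall i, cylinder (d i) z.
  apply: cylinder_chain => i; first by have [] := eP (i.+1, c i.+1) (cpos _).
  by have [] := eP (i, c i) (cpos _).
have : (K `&` spots_io x) z; last by rewrite Kx.
split.
  apply: (closed_limit cK) => n; exists (d n); split=> //.
    by have [] := eP (n, c n) (cpos _).
  rewrite setIC; apply/set0P; apply: contraTneq (cpos n.+1) => Kd.
  by rewrite /pos -/(d n) Kd measure0 ltxx.
move=> k _; have [_ _ _ [n kn dn]] := eP (k, c k) (cpos _).
by exists n => //; apply: dn; exact: zP.
Qed.

(** At level [n] at most [n.+1] cylinders are consulted, each contributing at most [n * 2 ^ n.+1]
    values. *)
Definition width (n : nat) := (n.+1 * (n * 2 ^ n.+1))%N.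

(** One slalom must serve all [x], while the cylinder and its constant depend on [x]. So level [n]
    collects the values for every cylinder with code and constant at most [n]; each cylinder enters
    eventually. *)
Lemma null_localization A : mu.-negligible A -> exists2 S : nat -> seq nat,
  (forall n, (size (S n) <= width n)%N) &
  forall x, spots_io x `<=` A -> eventually_in x S.
Proof.
move=> /(null_closed_disjoint mu_leb)[K [cK K0 KA]].
have mK : measurable (K : set borel_baire) by exact: closed_borel.
have /choice[c cP] : forall j, exists c, (0 < mu (K `&` cylinder (sqn j)))%E -> 
    forall n L, uniq L ->
    (forall m, m \in L -> mu (K `&` cylinder (sqn j) `&` spot n m) = 0%E) ->
    (size L <= c * 2 ^ n.+1)%N.
  move=> j; have [j0|] := pselect (0 < mu (K `&` cylinder (sqn j)))%E; last by exists 0%N.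
  have [|c cP] := positive_spots_bound _ j0; last by exists c.
  by apply: measurableI => //; exact: measurable_cylinder.
have /choice[L LP] : forall jn : nat * nat, exists L : seq nat,
    (size L <= c jn.1 * 2 ^ jn.2.+1)%N /\ ((0 < mu (K `&` cylinder (sqn jn.1)))%E ->
    forall m, mu (K `&` cylinder (sqn jn.1) `&` spot jn.2 m) = 0%E -> m \in L).
  move=> [j n] /=; have [j0|] := pselect (0 < mu (K `&` cylinder (sqn j)))%E; last by exists [::].
  have [L Lsz LP] := bounded_enum (cP _ j0 n).
  by exists L.
pose J n := [seq j <- iota 0 n.+1 | (c j <= n)%N].
exists (fun n => flatten [seq L (j, n) | j <- J n]).
  move=> n; rewrite size_flatten /shape -map_comp sumnE big_map /width.
  apply: (@leq_trans (\sum_(j <- J n) n * 2 ^ n.+1)%N).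
    rewrite big_seq [leqRHS]big_seq; apply: leq_sum => j.
    rewrite mem_filter => /andP[cjn _]; apply: leq_trans (LP (j, n)).1 _.
    by rewrite leq_mul2r cjn orbT.
  rewrite big_const_seq count_predT iter_addn_0 mulnC leq_mul2r; apply/orP; right.
  by rewrite size_filter (leq_trans (count_size _ _))// size_iota.
move=> x xA; have [|s [k [s0 sk]]] := @positive_spots_null K x cK K0.
  by rewrite -subset0 -KA; exact: setIS.
exists (maxn k (maxn (pickle s) (c (pickle s)))) => n.
rewrite !geq_max => /and3P[kn sn cn]; apply/flattenP; exists (L (pickle s, n)).
  apply/mapP; exists (pickle s) => //.
  by rewrite mem_filter cn mem_iota add0n ltnS.
by apply: (LP (pickle s, n)).2 => /=; rewrite sqnK//; exact: sk.
Qed.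

End null_localization.

(** * Cantor schemes *)

Section cantor_schemes.
Variables (R : realType) (mu : {measure set borel_baire -> \bar R}).
Hypothesis mu_leb : is_baire_lebesgue mu.

(** Both localizations use the same width, so the slalom obtained from a null set containing [phi A]
    captures the code of [A]. *)
Lemma meager_null_tukey : exists phi psi : set baire -> set baire,
  [/\ forall A, meager_ideal A -> null_ideal mu (phi A),
      forall B, null_ideal mu B -> meager_ideal (psi B) &
      forall A B, meager_ideal A -> null_ideal mu B -> phi A `<=` B -> A `<=` psi B].
Proof.
have [f fP] := meager_localization width.
have /choice[S SP] : forall B : set baire, exists S : nat -> seq nat,
    (forall n, (size (S n) <= width n)%N) /\
    (null_ideal mu B -> forall x, spots_io x `<=` B -> eventually_in x S).
  move=> B; have [nB|nB] := pselect (null_ideal mu B); last by exists (fun=> [::]).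
  by have [S S1 S2] := null_localization mu_leb nB; exists S.
exists (fun A => spots_io (f A)), (fun B => slalom_meager width (S B)).
split=> [A _|B _|A B mA nB AB]; first exact: spots_io_null.
- by apply: slalom_meagerP; have [] := SP B.
- by apply: fP => //; have [_] := SP B; apply.
Qed.

Lemma mu_bigsetU_le (I : Type) (r : seq I) (F : I -> set borel_baire) :
  (forall i, measurable (F i)) ->
  (mu (\big[setU/set0]_(i <- r) F i) <= \sum_(i <- r) mu (F i))%E.
Proof.
move=> mF; elim: r => [|i r IH]; first by rewrite !big_nil measure0.
rewrite !big_cons; apply: le_trans (measureU2 mu (mF i) _) _.
  by elim/big_ind : _ => // *; exact: measurableU.
exact: leeD2l.
Qed.

(* Two cylinders of length at least [2 n] at each node of level [n] make the set
   of branches null, and finitely many nodes at each level make it nowhere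
   dense. *)
Lemma cantor_scheme (P : nat -> seq nat -> Prop) : P 0%N [::] ->
  (forall n s, P n s -> exists t u,
     [/\ P n.+1 t, P n.+1 u, cylinder t `<=` cylinder s, cylinder u `<=` cylinder s &
         [/\ cylinder t `&` cylinder u = set0, (n.+1.*2 <= size t)%N &
            (n.+1.*2 <= size u)%N]]) ->
  exists Z : set baire, [/\ null_ideal mu Z, meager_ideal Z, [set: baire] #<= Z &
    forall z n, Z z -> exists s, [/\ P n s, (n <= size s)%N & cylinder s z]].
Proof.
move=> P0 PS; have /choice[e eP] : forall ns : nat * seq nat, exists tu : seq nat * seq nat,
    P ns.1 ns.2 -> [/\ P ns.1.+1 tu.1, P ns.1.+1 tu.2, cylinder tu.1 `<=` cylinder ns.2,
     cylinder tu.2 `<=` cylinder ns.2 &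
     [/\ cylinder tu.1 `&` cylinder tu.2 = set0, (ns.1.+1.*2 <= size tu.1)%N &
       (ns.1.+1.*2 <= size tu.2)%N]].
  move=> [n s]; have [/PS[t [u H]]|] := pselect (P n s); first by exists (t, u).
  by exists ([::], [::]).
pose fix c (l : seq bool) := if l is b :: l' then
  let tu := e (size l', c l') in if b then tu.1 else tu.2 else [::].
have cP l : P (size l) (c l).
  by elim: l => //= b l /(eP (size l, c l))[/= ? ? _ _ _]; case: b.
have csz l : ((size l).*2 <= size (c l))%N.
  by case: l => //= b l; have [_ _ _ _ [_ ? ?]] := eP (size l, c l) (cP l); case: b.
have cS b l : cylinder (c (b :: l)) `<=` cylinder (c l).
  by have [_ _ ? ? _] := eP (size l, c l) (cP l); case: b.
pose fix pre (x : nat -> bool) n := if n is m.+1 then x m :: pre x m else [::].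
have szpre x n : size (pre x n) = n by elim: n => //= n ->.
have /choice[z zP] : forall x, exists z, forall i, cylinder (c (pre x i)) z.
  move=> x; apply: cylinder_chain => i; first exact: cS.
  by apply: leq_trans (csz _); rewrite szpre -addnn leq_addr.
have zinj : injective z.
  move=> x y zxy; apply/funext => n.
  have pre_eq : pre x n = pre y n /\ x n = y n; last by case: pre_eq.
  have step m : pre x m = pre y m -> x m = y m.
    move=> pm; have := zP x m.+1; have := zP y m.+1; rewrite -zxy /= -pm.
    have [_ _ _ _ [/seteqP[tu0 _] _ _]] := eP (size (pre x m), c (pre x m)) (cP _).
    by case: (x m) (y m) => -[] // h1 h2; case: (tu0 (z x)).
  have pn : pre x n = pre y n by elim: n => //= n IH; rewrite IH step.
  by split=> //; exact: step.
pose tpre x n := tcast (szpre x n) (in_tuple (pre x n)).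
have tpreE x n : tpre x n = pre x n :> seq bool by rewrite val_tcast.
exists (range z); split.
- pose U n := \big[setU/set0]_(l : n.-tuple bool) (cylinder (c l) : set borel_baire).
  have mU n : measurable (U n).
    by rewrite /U; elim/big_ind : _ => // *; [exact: measurableU|exact: measurable_cylinder].
  have mI : measurable (\bigcap_n U n) by exact: bigcapT_measurable.
  exists (\bigcap_n U n); split=> //; last first.
    move=> _ [x _ <-] n _.
    by rewrite /U (bigD1 (tpre x n))//=; left; rewrite tpreE.
  apply/eqP; apply: contrapT => /negP; rewrite -measure_gt0.
  move=> /(half_pow_lt_mu mu_leb mI)[n]; apply/negP; rewrite -leNgt.
  apply: (@le_trans _ _ (mu (U n))).
    by apply: le_measure; rewrite ?inE//; exact: bigcap_inf.
  apply: le_trans (mu_bigsetU_le _ _) _ => [l|]; first exact: measurable_cylinder.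
  apply: (@le_trans _ _ (\sum_(l : n.-tuple bool) ((2^-1) ^+ n.*2)%:E)%E).
    apply: lee_sum => l _; apply: le_trans (mu_cylinder_le mu_leb _) _.
    rewrite lee_fin; apply: ler_wiXn2l; rewrite ?invr_ge0// ?invf_le1 ?ler1n//.
    by rewrite (leq_trans _ (csz _))// size_tuple.
  rewrite sumEFin sumr_const card_tuple card_bool -[_ *+ (2 ^ n)]mulr_natr natrX -addnn exprD.
  by rewrite -mulrA -exprMn mulVf ?pnatr_eq0// expr1n mulr1.
- exists (fun=> range z); split=> [_|]; last by move=> x zx; exists 0%N.
  apply/nowhere_denseP => s.
  pose n := (size s).+1.
  (* Every node of level [n] has an entry at position [size s]; a larger value there excludes all
     branches. *)
  pose k := (\max_(l : n.-tuple bool) nth 0%N (c l) (size s)).+1.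
  exists (rcons s k); first by rewrite cylinder_rcons => ? [].
  rewrite cylinder_rcons; apply/seteqP; split=> // w [[_ /= wk] [x _ xw]].
  have := @leq_bigmax _ (fun l : n.-tuple bool => nth 0%N (c l) (size s)) (tpre x n).
  rewrite tpreE -(zP x n) ?xw ?wk /k ?ltnn//.
  by rewrite (leq_trans _ (csz _))// szpre /n -addnn ltn_addr.
(* A point of the Baire space becomes a binary sequence, the characteristic function of its
   graph. *)
- pose code (x : baire) (p : nat) :=
    if unpickle p is Some nm then x (nm : nat * nat).1 == nm.2 else false.
  have code_inj : injective code.
    move=> x y xy; apply/funext => n; have := congr1 (@^~ (pickle (n, x n))) xy.
    by rewrite /code /= pickleK /= eqxx => /esym/eqP.
  have /card_eqPle[_ le] : (z \o code) @` setT #= [set: baire].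
    by apply: inj_card_eq => x y _ _ /zinj/code_inj.
  apply: card_le_trans le _; apply: subset_card_le => _ [x _ <-].
  by exists (code x).
move=> _ n [x _ <-]; exists (c (pre x n)); split=> //.
- by have := cP (pre x n); rewrite szpre.
- by apply: leq_trans (csz _); rewrite szpre -addnn leq_addr.
Qed.
End cantor_schemes.

(** * Small sets of full cardinality inside complements *)

Section large_complements.
Variables (R : realType) (mu : {measure set borel_baire -> \bar R}).
Hypothesis mu_leb : is_baire_lebesgue mu.

Definition large_complements (I : set (set baire)) := forall A, I A ->
  exists Z : set baire, [/\ I Z, Z `&` A = set0 & [set: baire] #<= Z].

(** The nodes are cylinders that meet [K] in positive measure; closedness puts all branches into
    [K]. *)
Lemma null_large_complements : large_complements (null_ideal mu).
Proof.
move=> A /(null_closed_disjoint mu_leb)[K [cK K0 KA]].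
have mK : measurable (K : set borel_baire) by exact: closed_borel.
have mKs s : measurable (K `&` cylinder s : set borel_baire).
  by apply: measurableI => //; exact: measurable_cylinder.
pose P (n : nat) s := (0 < mu (K `&` cylinder s))%E.
have [||Z [Znull _ cZ ZP]] := @cantor_scheme _ mu mu_leb P.
- by rewrite /P cylinder_nil setIT.
- move=> n s; rewrite /P => s0; have [m ms] := half_pow_lt_mu mu_leb (mKs s) s0.
  (* Since [p >= m], a cylinder of length [p] has smaller measure than [K] inside [s], so [t] leaves
     room for a second node. *)
  pose p := maxn m (maxn (size s) n.+1.*2).
  have [t tp t0] := positive_extension p (mKs s) s0.
  have mKst : measurable (K `&` cylinder s `\` cylinder t : set borel_baire).
    by apply: measurableD => //; exact: measurable_cylinder.
  have [|u up u0] := @positive_extension _ mu _ p mKst.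
    rewrite lt_neqAle measure_ge0 andbT eq_sym; apply/eqP => D0.
    have E : mu (K `&` cylinder s) = (mu (K `&` cylinder s `\` cylinder t) +
        mu (K `&` cylinder s `&` cylinder t))%E.
      by apply: measureDI => //; exact: measurable_cylinder.
    move: ms; rewrite E D0 add0e.
    apply/negP; rewrite -leNgt; apply: (@le_trans _ _ (mu (cylinder t))).
      by apply: le_measure; rewrite ?inE//; [apply: measurableI => //|];
        exact: measurable_cylinder.
    apply: le_trans (mu_cylinder_le mu_leb _) _; rewrite lee_fin.
    by apply: ler_wiXn2l; rewrite ?invr_ge0// ?invf_le1 ?ler1n// tp leq_maxl.
  have [y [[Ky sy] ty]] : (K `&` cylinder s `&` cylinder t) !=set0.
    by apply/set0P; apply: contraTneq t0 => ->; rewrite measure0 ltxx.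
  have [w [[[Kw sw] nt] uw]] : ((K `&` cylinder s `\` cylinder t) `&` cylinder u) !=set0.
    by apply/set0P; apply: contraTneq u0 => ->; rewrite measure0 ltxx.
  exists t, u; split.
  + apply: lt_le_trans t0 _; apply: le_measure; rewrite ?inE//.
      by apply: measurableI => //; exact: measurable_cylinder.
    by move=> z [[Kz _] tz].
  + apply: lt_le_trans u0 _; apply: le_measure; rewrite ?inE//.
      by apply: measurableI => //; exact: measurable_cylinder.
    by move=> z [[[Kz _] _] uz].
  + by apply: (sub_cylinder _ sy ty); rewrite tp /p; lia.
  + by apply: (sub_cylinder _ sw uw); rewrite up /p; lia.
  split; [|by rewrite tp /p; lia|by rewrite up /p; lia].
  apply/seteqP; split=> // z [tz uz]; apply: nt.
  by move=> i it; rewrite uw ?up -?tp// -uz ?up -?tp// tz.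
exists Z; split=> //; apply/seteqP; split=> // z [Zz Az].
suff Kz : K z by have : (K `&` A) z by []; rewrite KA.
apply: (closed_limit cK) => n; have [s [+ ns sz]] := ZP z n Zz; rewrite /P => ps.
exists s; split=> //; rewrite setIC; apply/set0P.
by apply: contraTneq ps => ->; rewrite measure0 ltxx.
Qed.

(** Nodes of level [n] avoid the first [n] nowhere dense sets, so no branch lies in any of them. *)
Lemma meager_large_complements : large_complements meager_ideal.
Proof.
move=> A [F [ndF AF]].
pose P (n : nat) s := forall i, (i < n)%N -> cylinder s `&` F i = set0.
have [||Z [_ Zmeager cZ ZP]] := @cantor_scheme _ mu mu_leb P; first by [].
  move=> n s _; have [t ts tF] := nowhere_dense_finU ndF n s.
  (* Zeros supply the required length, and the last entry separates the two nodes. *)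
  pose v b := rcons (t ++ nseq n.+1.*2 0%N) b.
  have vt b : cylinder (v b) `<=` cylinder t.
    move=> y vy i it; rewrite vy /v; last by rewrite size_rcons size_cat; lia.
    by rewrite nth_rcons nth_cat size_cat it (leq_trans it)// leq_addr.
  have vP b : P n.+1 (v b).
    by move=> i ni; rewrite -subset0 -(tF i ni); exact: setSI.
  have vn b : (n.+1.*2 <= size (v b))%N by rewrite size_rcons size_cat size_nseq; lia.
  exists (v 0%N), (v 1%N); split=> //; try exact: subset_trans ts.
  split=> //; rewrite !cylinder_rcons; apply/seteqP; split=> // y [[_ /= y0] [_ /=]].
  by rewrite y0.
exists Z; split=> //; apply/seteqP; split=> // z [Zz /AF[i _ Fz]].
have [s [ps _ sz]] := ZP z i.+1 Zz.
by have : (cylinder s `&` F i) z by []; rewrite ps.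
Qed.

End large_complements.

(** * Ideals with a well-ordered base *)

Record strict_well_order (W : Type) (lt : W -> W -> Prop) : Prop := StrictWellOrder {
  swo_wf : well_founded lt;
  swo_total : forall a b, [\/ lt a b, a = b | lt b a] }.

Section strict_well_orders.
Variables (W : Type) (lt : W -> W -> Prop).
Hypothesis lt_wo : strict_well_order lt.

Lemma swo_least (P : W -> Prop) : (exists w, P w) ->
  exists2 w, P w & forall v, lt v w -> ~ P v.
Proof.
move=> [w Pw]; apply: contrapT => nP; move: Pw; elim/(well_founded_ind (swo_wf lt_wo)): w.
by move=> w IH Pw; apply: nP; exists w.
Qed.

End strict_well_orders.

(* The base is made increasing by well-founded recursion, each stage also taking
   in a set of full cardinality disjoint from the earlier stages; the rank of a
   point is the first stage that contains it. *)
Lemma ideal_rank (X W : Type) (lt : W -> W -> Prop) (I : set (set X)) (base : W -> set X) :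
  strict_well_order lt ->
  (forall A B, A `<=` B -> I B -> I A) -> (forall A B, I A -> I B -> I (A `|` B)) ->
  (forall x, I [set x]) -> (forall w, I (base w)) ->
  (forall A, I A -> exists w, A `<=` base w) ->
  (forall w (F : W -> set X), (forall v, lt v w -> I (F v)) ->
    I (\bigcup_(v in [set v | lt v w]) F v)) ->
  (forall A, I A -> exists Z : set X, [/\ I Z, Z `&` A = set0 & [set: X] #<= Z]) ->
  exists rho : X -> W,
    (forall A, I A <-> exists w, forall x, A x -> ~ lt w (rho x)) /\
    forall w, (rho @^-1` [set w]) #= [set: X].
Proof.
move=> wo IS IU I1 Ibase Icof Ibig Ilarge.
have /choice[z zP] : forall A, exists Z : set X, I A ->
    [/\ I Z, Z `&` A = set0 & [set: X] #<= Z].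
  by move=> A; have [/Ilarge[Z ZP]|] := pselect (I A); [exists Z|exists set0].
pose step w (rec : forall v, lt v w -> set X) :=
  let P := base w `|` [set x | exists v (vw : lt v w), rec v vw x] in P `|` z P.
pose N := Fix (swo_wf wo) (fun=> set X) step.
pose P w := base w `|` \bigcup_(v in [set v | lt v w]) N v.
have NE w : N w = P w `|` z (P w).
  rewrite /N Fix_eq => [|v f g fg]; last first.
    by congr (step v _); do 2 (apply: functional_extensionality_dep => ?).
  rewrite /step -/N; have -> // : base w `|` [set x | exists v (_ : lt v w), N v x] = P w.
  by congr (_ `|` _); apply/seteqP; split=> [x [v [vw Nx]]|x [v vw Nx]]; exists v => //; exists vw.
have IN w : I (N w).
  elim/(well_founded_ind (swo_wf wo)): w => w IH.
  have IP : I (P w) by apply: IU => //; apply: Ibig.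
  by rewrite NE; apply: IU => //; have [] := zP _ IP.
have IP w : I (P w) by apply: IU => //; apply: Ibig.
have Nlt v w : lt v w -> N v `<=` N w.
  by move=> vw x Nx; rewrite NE; left; right; exists v.
have /choice[rho rhoP] : forall x, exists w, N w x /\ forall v, lt v w -> ~ N v x.
  move=> x; have [|w] := @swo_least _ _ wo (fun w => N w x); last by exists w.
  by have [w xw] := Icof _ (I1 x); exists w; rewrite NE; left; left; exact: xw.
exists rho; split=> [A|w].
  split=> [/Icof[w Aw]|[w Aw]].
    exists w => x /Aw bx /((rhoP x).2); apply.
    by rewrite NE; left; left.
  apply: IS (IN w) => x /Aw nwr; have := (rhoP x).1.
  by case: (swo_total wo (rho x) w) => [/Nlt|->|] //; apply.
have [_ zP0 zT] := zP _ (IP w).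
(* The fibre over [w] contains [z (P w)], which is disjoint from all earlier stages and as large as
   the space. *)
apply/card_eqPle; split; first exact: card_leT.
apply: card_le_trans zT _; apply: subset_card_le => x zx.
have Nwx : N w x by rewrite NE; right.
have [Nrx rmin] := rhoP x.
case: (swo_total wo (rho x) w) => [rw|//|wr]; last by have := rmin _ wr.
have : (z (P w) `&` P w) x by split=> //; right; exists (rho x).
by rewrite zP0.
Qed.

Lemma glue_fibres (X : pointedType) (W : Type) (r s : X -> W) :
  (forall w, (r @^-1` [set w]) #= (s @^-1` [set w])) ->
  exists h k : X -> X, [/\ cancel h k, cancel k h & forall x, s (h x) = r x].
Proof.
move=> rs; have /choice[g gP] : forall w, exists g : X -> X,
    set_bij (r @^-1` [set w]) (s @^-1` [set w]) g.
  by move=> w; apply/card_set_bijP.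
pose h x := g (r x) x.
have sh x : s (h x) = r x by have [gf _ _] := gP (r x); exact: (gf x).
have hinj : injective h.
  move=> x y hxy; have rxy : r x = r y by rewrite -!sh hxy.
  have [_ gi _] := gP (r x); apply: (gi x y); rewrite ?inE//.
  by move: hxy; rewrite /h -rxy.
have /choice[k hk] : forall y, exists x, h x = y.
  move=> y; have [_ _ gs] := gP (s y); have [x /= rx xy] := gs y erefl.
  by exists x; rewrite /h rx.
by exists h, k; split=> // x; apply: hinj.
Qed.

(** Enumerates [F] in the order type of its cardinal: in a well-order of [T], [D] is the first
    proper initial segment of [F] that is as large as [F], or [F] itself if there is none. *)
Lemma short_well_order (T : pointedType) (F : set T) : exists (W : Type)
  (lt : W -> W -> Prop) (c : W -> T), [/\ strict_well_order lt,
    forall w, F (c w), forall a, F a -> exists w, c w = a &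
    forall w, ~ (F #<= [set v | lt v w])].
Proof.
have [Rl Rwo] := well_ordering_principle T.
have Rmin (A : set T) a : A a -> exists2 m, A m & forall b, A b -> Rl m b.
  move=> Aa; have [|m [[mA mP] _]] := Rwo [pred x | `[< A x >]].
    by exists a; apply/asboolP.
  by exists m => [|b Ab]; [exact/asboolP|apply: mP; apply/asboolP].
pose ltR a b := Rl a b /\ a <> b.
have Rtot a b : Rl a b \/ Rl b a.
  have [//|m [->|->] mP] := Rmin [set x | x = a \/ x = b] a; first by left.
    by left; apply: mP; right.
  by right; apply: mP; left.
have Ranti a b : Rl a b -> Rl b a -> a = b.
  move=> ab ba; have [|m [mm mU]] := Rwo [pred x | (x == a) || (x == b)].
    by exists a; rewrite inE /= eqxx.
  have Raa x : Rl x x by case: (Rtot x x).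
  by transitivity m; [symmetry|]; apply: mU; split; rewrite ?inE/= ?eqxx ?orbT//;
    move=> x /orP[] /eqP ->.
have ltR_wo : strict_well_order ltR.
  split=> [a|a b].
    apply: contrapT => na; have [m nm mP] := Rmin [set x | ~ Acc ltR x] a na.
    apply: nm; constructor => b [bm nbm]; apply: contrapT => nb.
    by apply: nbm; apply: Ranti bm _; apply: mP.
  have [->|/eqP ab] := eqVneq a b; first by constructor 2.
  by case: (Rtot a b) => H; [constructor 1|constructor 3]; split=> // /esym.
have [D [DF FD Dlt]] : exists D : set T, [/\ D `<=` F, F #<= D &
    forall b, D b -> ~ (F #<= [set d | D d /\ ltR d b])].
  have [ex|nex] := pselect (exists a, F a /\ F #<= [set d | F d /\ ltR d a]).
    have [a [Fa Fle] amin] := swo_least ltR_wo ex.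
    exists [set d | F d /\ ltR d a]; split=> // [d []//|b [Fb ba] Fle'].
    apply: (amin _ ba); split=> //; apply: card_le_trans Fle' _.
    by apply: subset_card_le => d [[? _] ?].
  by exists F; split=> // b Fb Fle; apply: nex; exists b.
have /card_set_bijP[g [gfun _ gsurj]] : D #= F.
  by apply/card_eqPle; split=> //; exact: subset_card_le.
exists {x : T | D x}, (fun v w => ltR (sval v) (sval w)), (fun w => g (sval w)); split.
- split=> [[a Da]|[a Da] [b Db]] /=.
    elim/(well_founded_ind (swo_wf ltR_wo)): a Da => a IH Da.
    by constructor=> -[b Db] /= ba; exact: IH.
  case: (swo_total ltR_wo a b) => [|ab|]; [by constructor 1| |by constructor 3].
  by constructor 2; apply: eq_exist.
- by move=> [a Da]; apply: gfun.
- by move=> a /gsurj[d Dd <-]; exists (exist _ d Dd).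
move=> [b Db] /= Fle; apply: (Dlt b Db); apply: card_le_trans Fle _.
have inj : {in [set v : {x | D x} | ltR (sval v) b] &, injective sval}.
  by move=> [x Dx] [y Dy] _ _ /= xy; apply: eq_exist.
have /card_eqPle[_ le] := inj_card_eq inj.
apply: card_le_trans le _; apply: subset_card_le => _ [[x Dx] /= xb <-].
by split.
Qed.

Lemma min_size_bij (T : Type) (u v : T -> T) (P Q : set (set T)) :
  cancel u v -> cancel v u -> (forall A, P (u @` A) <-> Q A) -> min_size P #= min_size Q.
Proof.
move=> uv vu PQ.
have image_eq (f g : T -> T) A : cancel f g -> f @` A #= A.
  by move=> fg; apply: inj_card_eq => x y _ _; exact: (can_inj fg).
have QP A : P A -> Q (v @` A).
  move=> PA; apply/PQ; rewrite image_comp.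
  have -> : u \o v = id by apply/funext.
  by rewrite image_id.
have [Q0|/set0P/negP/negPn/eqP Q0] := pselect (Q !=set0); last first.
  have -> : P = set0 by apply/seteqP; split=> // A /QP; rewrite Q0.
  by rewrite Q0.
have P0 : P !=set0 by have [A /PQ] := Q0; exists (u @` A).
have [QB Bmin] := min_sizeP Q0; have [PA Amin] := min_sizeP P0.
apply/card_eqPle; split.
  have /card_eqPle[le _] := image_eq _ _ (min_size Q) uv.
  by apply: card_le_trans (Amin _ _) le; apply/PQ.
have /card_eqPle[le _] := image_eq _ _ (min_size P) vu.
by apply: card_le_trans (Bmin _ _) le; apply: QP.
Qed.

(** * The Erdos-Sierpinski bijection *)

Section transfer.
Variables (I J : set (set baire)) (h k : baire -> baire).
Hypotheses (hK : cancel h k) (kK : cancel k h).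
Hypothesis IJ : forall E, I (h @^-1` E) <-> J E.

(** The exceptional set of the composed functions is the preimage under [h] of the original one. *)
Lemma rel_mod_comp (Y : Type) (S : baire -> Y -> Prop) f g :
  rel_mod I S (f \o h) (g \o h) <-> rel_mod J S f g.
Proof. by rewrite /rel_mod -IJ. Qed.

Let precomp_hK (Y : Type) : cancel (fun f : baire -> Y => f \o h) (fun f => f \o k).
Proof. by move=> f; apply/funext => x /=; rewrite kK. Qed.

Let precomp_kK (Y : Type) : cancel (fun f : baire -> Y => f \o k) (fun f => f \o h).
Proof. by move=> f; apply/funext => x /=; rewrite hK. Qed.

Lemma bnum_transfer (Y : Type) (S : baire -> Y -> Prop) : bnum I S #= bnum J S.
Proof.
apply: min_size_bij (@precomp_hK baire) (@precomp_kK baire) _ => A.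
split=> nA [g gA]; apply: nA.
  exists (g \o h) => _ [f Af <-]; apply/rel_mod_comp; exact: gA.
exists (g \o k) => f Af; apply/rel_mod_comp; rewrite precomp_kK.
by apply: gA; exists f.
Qed.

Lemma dnum_transfer (Y : Type) (S : baire -> Y -> Prop) : dnum I S #= dnum J S.
Proof.
apply: min_size_bij (@precomp_hK Y) (@precomp_kK Y) _ => A.
split=> AP g.
  have [_ [f Af <-] fg] := AP (g \o h).
  by exists f => //; apply/rel_mod_comp.
have [f Af fg] := AP (g \o k); exists (f \o h); first by exists f.
by rewrite -(precomp_kK g); apply/rel_mod_comp.
Qed.

End transfer.

(** * Matching the chains of null and of meager sets *)

Section erdos_sierpinski.
Variables (R : realType) (mu : {measure set borel_baire -> \bar R}).
Hypothesis mu_leb : is_baire_lebesgue mu.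
Hypothesis cof_add : cof_ideal (null_ideal mu) #= add_ideal (null_ideal mu).

Lemma null_set1 (x : baire) : null_ideal mu [set x].
Proof.
have mx : measurable ([set x] : set borel_baire).
  apply: closed_borel; rewrite (_ : [set x] = \bigcap_n cylinder (mkseq x n)).
    by apply: closed_bigI => n _; exact: closed_cylinder.
  apply/seteqP; split=> [_ -> n _|y xy]; first exact: cylinder_mkseq.
  apply/funext => n; have := xy n.+1 I n; rewrite size_mkseq ltnSn nth_mkseq//.
  exact.
exists [set x]; split=> //; apply/eqP; apply: contrapT => /negP.
rewrite -measure_gt0 => /(half_pow_lt_mu mu_leb mx)[n]; apply/negP; rewrite -leNgt.
have := mu_cylinder_le mu_leb (mkseq x n); rewrite size_mkseq; apply: le_trans.
apply: le_measure; rewrite ?inE//; first exact: measurable_cylinder.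
by move=> _ ->; exact: cylinder_mkseq.
Qed.

Lemma meager_set1 (x : baire) : meager_ideal [set x].
Proof.
exists (fun=> [set x]); split=> [_|y yx]; last by exists 0%N.
apply/nowhere_denseP => s; exists (rcons s (x (size s)).+1); rewrite cylinder_rcons.
  by move=> y [].
by apply/seteqP; split=> // y [[_ /= ys] yx]; move: ys; rewrite yx => /eqP; rewrite ltn_eqF.
Qed.

Lemma null_setTN : ~ null_ideal mu setT.
Proof.
move=> nT; have : mu setT = 0%E by apply: measure_negligible.
by apply/eqP; rewrite (mu_setT mu_leb) onee_neq0.
Qed.

(** The order has the length of the additivity, so the stages before a given one are too few for
    their union to leave the ideal; as the cofinality is the same, this order also enumerates a
    cofinal family. *)
Lemma null_base : exists (W : Type) (lt : W -> W -> Prop) (base : W -> set baire),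
  [/\ strict_well_order lt, forall w, null_ideal mu (base w),
      forall A, null_ideal mu A -> exists w, A `<=` base w &
      forall w (F : W -> set baire), (forall v, lt v w -> null_ideal mu (F v)) ->
        null_ideal mu (\bigcup_(v in [set v | lt v w]) F v)].
Proof.
have [_ addP] : is_min_size [set F | F `<=` null_ideal mu /\
    ~ null_ideal mu (\bigcup_(A in F) A)] (add_ideal (null_ideal mu)).
  (* The singletons form a family with non-null union, so [add_ideal] is a true minimum and not the
     default. *)
  apply: min_sizeP; exists (range set1).
  split=> [_ [x _ <-]|]; first exact: null_set1.
  rewrite (_ : \bigcup_(A in range set1) A = setT); first exact: null_setTN.
  by apply/seteqP; split=> // x _; exists [set x] => //; exists x.
have [[cofI cofP] _] : is_min_size [set B | B `<=` null_ideal mu /\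
    forall A, null_ideal mu A -> exists2 C, B C & A `<=` C] (cof_ideal (null_ideal mu)).
  by apply: min_sizeP; exists (null_ideal mu); split=> // A nA; exists A.
have [W [lt [c [wo cF cs csmall]]]] := short_well_order (add_ideal (null_ideal mu)).
have /card_set_bijP[g [gfun _ gsurj]] :
    add_ideal (null_ideal mu) #= cof_ideal (null_ideal mu) by rewrite card_eq_sym.
exists W, lt, (fun w => g (c w)); split=> // [w|A /cofP[C]|w F FI].
- by apply: cofI; apply: gfun; exact: cF.
- by move=> /gsurj[D /cs[w <-] <-] AC; exists w.
apply: contrapT => nF; apply: (csmall w).
apply: card_le_trans (card_image_le F _); apply: addP; split.
  by move=> _ [v vw <-]; exact: FI.
by rewrite bigcup_image.
Qed.

(** In both ideals membership becomes boundedness of a rank into the same order [W], with fibres of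
    full size; gluing bijections of the fibres carries one rank to the other. *)
Lemma null_meager_bijection : exists h k : baire -> baire,
  [/\ cancel h k, cancel k h &
      forall E, null_ideal mu (h @^-1` E) <-> meager_ideal E].
Proof.
have [W [lt [base [wo base_null base_cof base_add]]]] := null_base.
have [phi [psi [phiP psiP phi_psi]]] := meager_null_tukey mu_leb.
have nullS (A B : set baire) : A `<=` B -> null_ideal mu B -> null_ideal mu A.
  exact: (@negligibleS _ _ _ mu B A).
have nullU (A B : set baire) : null_ideal mu A -> null_ideal mu B ->
    null_ideal mu (A `|` B).
  exact: (@negligibleU _ _ _ mu A B).
have meagerS (A B : set baire) : A `<=` B -> meager_ideal B -> meager_ideal A.
  by move=> AB [F [ndF BF]]; exists F; split=> //; exact: subset_trans BF.
have [r [rI rfib]] := ideal_rank wo nullS nullU null_set1 base_null base_cof base_add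
  (null_large_complements mu_leb).
have [||||||s [sI sfib]] := @ideal_rank baire W lt meager_ideal (psi \o base) wo meagerS.
- move=> A B mA mB; have nAB := nullU _ _ (phiP _ mA) (phiP _ mB).
  apply: meagerS (psiP _ nAB) => x [Ax|Bx].
    by apply: (phi_psi A) Ax => //; exact: subsetUl.
  by apply: (phi_psi B) Bx => //; exact: subsetUr.
- exact: meager_set1.
- by move=> w; apply: psiP.
- move=> A mA; have [w Aw] := base_cof _ (phiP _ mA).
  by exists w; apply: phi_psi.
(* The images under [phi] have a null union, and [psi] of that union covers the original one. *)
- move=> w F FI; have nF := base_add w (phi \o F) (fun v vw => phiP _ (FI v vw)).
  apply: meagerS (psiP _ nF) => x [v vw Fx].
  by apply: (phi_psi (F v)) Fx => //; [exact: FI|exact: bigcup_sup].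
- exact: (meager_large_complements mu_leb).
have [|h [k [hK kK hs]]] := @glue_fibres baire W r s.
  by move=> w; apply: card_eq_trans (rfib w) _; rewrite card_eq_sym; exact: sfib.
exists h, k; split=> // E; split=> [/rI[w wP]|/sI[w wP]].
  by apply/sI; exists w => y Ey; rewrite -(kK y) hs; apply: wP; rewrite /= kK.
by apply/rI; exists w => x Ehx; rewrite -hs; exact: wP.
Qed.

End erdos_sierpinski.

Theorem theorem1p3 (R : realType) (mu : {measure set borel_baire -> \bar R})
    (mu_leb : is_baire_lebesgue mu)
    (cof_add : (cof_ideal (null_ideal mu) #= add_ideal (null_ideal mu))) :
  ((bnum (null_ideal mu) in_star #= bnum meager_ideal in_star) /\
   (dnum (null_ideal mu) in_star #= dnum meager_ideal in_star)) /\
  ((bnum (null_ideal mu) le_star #= bnum meager_ideal le_star) /\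
   (dnum (null_ideal mu) le_star #= dnum meager_ideal le_star)) /\
  ((bnum (null_ideal mu) neq_star #= bnum meager_ideal neq_star) /\
   (dnum (null_ideal mu) neq_star #= dnum meager_ideal neq_star)).
Proof.
have [h [k [hK kK hE]]] := null_meager_bijection mu_leb cof_add.
have b (Y : Type) (S : baire -> Y -> Prop) := bnum_transfer hK kK hE S.
have d (Y : Type) (S : baire -> Y -> Prop) := dnum_transfer hK kK hE S.
by do !split.
Qed.
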